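(* Equip every finite-dimensional, second-countable, Hausdorff smooth manifold $M$ with the sample-smooth structure $$M^{\Omega_n}:=\{p:\Omega_n\to M\ :\ p(-,\omega)\in C^\infty(\mathbb{R}^n,M)\ \forall\omega\in\Omega,\ \ p(t,-)\text{ is }\mathcal{B}_\Omega\text{-}\mathcal{B}_M\text{-measurable }\forall t\in\mathbb{R}^n\},$$ where $\mathcal{B}_M$ is the Borel $\sigma$-algebra of $M$. Then the assignment $M\mapsto M$ is a full and faithful functor from the category of finite-dimensional second-countable Hausdorff smooth manifolds and smooth maps into $\mathbf{SSS}$, and it preserves finite products.
   Context: **Sample space.** $\Omega=[0,1]^{\mathbb{N}}$; $\mathcal{B}_\Omega$ is the universal completion of its Borel (product) $\sigma$-algebra, i.e. all universally measurable subsets; $\Omega^\Omega$ is the set of all $\mathcal{B}_\Omega$-$\mathcal{B}_\Omega$-measurable self-maps of $\Omega$. **Site.** $\Omega_n:=\mathbb{R}^n\times\Omega$, $n\ge0$. A map $g:\Omega_m\to\mathbb{R}^n$ is mixed-smooth, $g\in\mathcal{C}^\infty_{\mathrm{mix}}(\Omega_m,\mathbb{R}^n)$, if (M1) $g(-,\omega)\in C^\infty(\mathbb{R}^m,\mathbb{R}^n)$ for every $\omega$, and (M2) $g(t,-)$ is $\mathcal{B}_\Omega$-Borel measurable for every $t$. The category $\mathbb{S}$ has objects $\Omega_n$ and morphisms $\mathbb{S}(\Omega_m,\Omega_n)=\{(g,\Phi): g\in\mathcal{C}^\infty_{\mathrm{mix}}(\Omega_m,\mathbb{R}^n),\Phi\in\Omega^\Omega\}$,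 where $(g,\Phi)(t,\omega)=(g(t,\omega),\Phi(\omega))$. **Sample-smooth spaces.** A sample-smooth space is a set $\mathcal{X}$ with, for each $n\ge0$, a set $\mathcal{X}^{\Omega_n}$ of maps $\Omega_n\to\mathcal{X}$ (plots) containing all constant maps and such that $p\in\mathcal{X}^{\Omega_n}$, $h\in\mathbb{S}(\Omega_m,\Omega_n)$ imply $p\circ h\in\mathcal{X}^{\Omega_m}$. A map $f:\mathcal{X}\to\mathcal{Y}$ is sample-smooth (a morphism of $\mathbf{SSS}$) if $f\circ p\in\mathcal{Y}^{\Omega_n}$ for all $n$ and $p\in\mathcal{X}^{\Omega_n}$. Products in $\mathbf{SSS}$ have the product underlying set and $(\prod_i\mathcal{X}_i)^{\Omega_n}=\prod_i\mathcal{X}_i^{\Omega_n}$. *)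

(* Defs.v *)
From HB Require Import structures.
From mathcomp Require Import all_boot all_order all_algebra.
From mathcomp Require Import all_classical all_reals all_analysis.

Set Implicit Arguments.
Unset Strict Implicit.
Unset Printing Implicit Defensive.

Import Order.TTheory GRing.Theory Num.Theory.
Import numFieldNormedType.Exports.

Local Open Scope classical_set_scope.
Local Open Scope ring_scope.

Section Ck.
Context {R : realType}.

(* Only used for U open in V = 'rV[R]_m, where, V being finite-dimensional,
   x |-> 'd f x is C^k iff x |-> 'd f x v = 'D_v f x is C^k for every v. *)
Fixpoint Ck_on (k : nat) {V W : normedModType R} (U : set V) (f : V -> W) :
    Prop :=
  if k is k'.+1 then
    (forall x, U x -> differentiable f x) /\ (forall v, Ck_on k' U ('D_v f))
  else forall x, U x -> {for x, continuous f}.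

Definition smooth_on {V W : normedModType R} (U : set V) (f : V -> W) : Prop :=
  forall k, Ck_on k U f.

Implicit Types V W : normedModType R.

Lemma Ck_onW k V W (U : set V) (f : V -> W) : Ck_on k.+1 U f -> Ck_on k U f.
Proof.
elim: k f => [|k IH] f.
  by move=> [df _] x Ux; apply: differentiable_continuous; exact: df.
by move=> [df Df]; split=> // v; apply: IH; exact: Df.
Qed.

Lemma Ck_on_sub k V W (U U' : set V) (f : V -> W) :
  U' `<=` U -> Ck_on k U f -> Ck_on k U' f.
Proof.
move=> sU; elim: k f => [|k IH] f /=; first by move=> cf x /sU; exact: cf.
by move=> [df Df]; split=> [x /sU|v]; [exact: df|exact/IH/Df].
Qed.

Lemma Ck_on_local k V W (U : set V) (f : V -> W) :
  (forall x, U x -> exists2 U' : set V, U' x & Ck_on k U' f) -> Ck_on k U f.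
Proof.
elim: k f => [|k IH] f /= H; first by move=> x Ux; case: (H x Ux) => U' U'x; exact.
split=> [x Ux|v]; first by case: (H x Ux) => U' U'x [+ _]; exact.
by apply: IH => x Ux; case: (H x Ux) => U' U'x [_ ?]; exists U'.
Qed.

Lemma near_eq_differentiable V W (f g : V -> W) (x : V) :
  (\near x, f x = g x) -> differentiable f x -> differentiable g x.
Proof.
move=> fg df.
suff dh : differentiable (g - f) x.
  have -> : g = f + (g - f) by apply/funext => y; rewrite !fctE addrC subrK.
  exact: differentiableD.
have h0 : \near x, (g - f) x = 0.
  by near=> y; rewrite !fctE (near fg y)// subrr.
have hx : (g - f) x = 0 := nbhs_singleton h0.
apply/diffP => /=.
apply: (@getPex _ (fun (df : {linear V -> W}) => continuous df /\
  forall y, (g - f) y = (g - f) (lim (nbhs x)) + df (y - lim (nbhs x))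
                  +o_(y \near x) (y - lim (nbhs x)))).
exists (\0 : {linear V -> W}); split; first exact: cst_continuous.
apply: (eqaddoEx (h := g - f)) => y; rewrite lim_id// hx !add0r /=.
rewrite littleoE// => e e0; near=> z; rewrite (near h0 z)// normr0.
by rewrite mulr_ge0// ltW.
Unshelve. all: by end_near. Qed.


Lemma Ck_on_eq k V W (U : set V) (f g : V -> W) :
  open U -> (forall x, U x -> f x = g x) -> Ck_on k U f -> Ck_on k U g.
Proof.
move=> oU; elim: k f g => [|k IH] f g fg.
  move=> cf x Ux; have : f y @[y --> x] --> g x by rewrite -fg//; exact: cf.
  apply: cvg_trans; apply: near_eq_cvg.
  by apply: filterS (open_nbhs_nbhs (conj oU Ux)) => y /fg.
have nfg x : U x -> \near x, f x = g x.
  by move=> Ux; apply: filterS (open_nbhs_nbhs (conj oU Ux)) => y /fg.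
move=> [df Df]; split=> [x Ux|v].
  by apply: near_eq_differentiable (df x Ux); exact: nfg.
by apply: IH (Df v) => x Ux; apply: near_eq_derive; exact: nfg.
Qed.

Lemma Ck_onD k V W (U : set V) (f g : V -> W) : open U ->
  Ck_on k U f -> Ck_on k U g -> Ck_on k U (fun x => f x + g x).
Proof.
move=> oU; elim: k f g => [|k IH] f g.
  by move=> cf cg x Ux; apply: cvgD; [exact: cf|exact: cg].
move=> [df Df] [dg Dg]; split=> [x Ux|v].
  by apply: differentiableD; [exact: df|exact: dg].
apply: Ck_on_eq (IH _ _ (Df v) (Dg v)) => // x Ux.
by rewrite [RHS]deriveD//; apply: diff_derivable; [exact: df|exact: dg].
Qed.

Lemma Ck_on_cst k V W (U : set V) (c : W) : Ck_on k U (fun=> c).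
Proof.
elim: k c => [|k IH] c; first by move=> x Ux; exact: cst_continuous.
split=> [x Ux|v]; first exact: differentiable_cst.
rewrite (_ : 'D_v _ = fun=> 0); first exact: IH.
by apply/funext => x; rewrite derive_cst.
Qed.

Lemma Ck_on_sum k V W (U : set V) n (f : 'I_n -> V -> W) : open U ->
  (forall i, Ck_on k U (f i)) -> Ck_on k U (fun x => \sum_i f i x).
Proof.
move=> oU; elim: n f => [|n IH] f cf.
  by under eq_fun do rewrite big_ord0; exact: Ck_on_cst.
under eq_fun do rewrite big_ord_recr.
by apply: Ck_onD => //=; exact: IH.
Qed.

Lemma Ck_onM k V (U : set V) (f g : V -> R) : open U ->
  Ck_on k U f -> Ck_on k U g -> Ck_on k U (fun x => f x * g x).
Proof.
move=> oU; elim: k f g => [|k IH] f g.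
  by move=> cf cg x Ux; apply: cvgM; [exact: cf|exact: cg].
move=> cf cg; have [[df Df] [dg Dg]] := (cf, cg); split=> [x Ux|v].
  by apply: differentiableM; [exact: df|exact: dg].
apply: Ck_on_eq (Ck_onD oU (IH _ _ (Ck_onW cf) (Dg v))
  (IH _ _ (Ck_onW cg) (Df v))) => // x Ux.
by rewrite [RHS]deriveM//; apply: diff_derivable; [exact: df|exact: dg].
Qed.

Lemma Ck_on_coord k V n (U : set V) (f : V -> 'rV[R]_n) : open U ->
  Ck_on k U f <-> forall j, Ck_on k U (fun x => f x ord0 j).
Proof.
move=> oU; elim: k f => [|k IH] f.
  split=> [cf j x Ux|cf x Ux].
    apply: (@continuous_comp _ _ _ f (fun M : 'rV[R]_n => M ord0 j)).
      exact: cf.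
    exact: coord_continuous.
  apply/cvgrPdist_lt => e e0; near=> y.
  rewrite /Num.Def.normr/= mx_normrE; apply/bigmax_ltP; split=> // -[i j] _ /=.
  rewrite ord1 !mxE; move: j; near: y.
  apply: filter_forall => j.
  have /cvgrPdist_lt/(_ e e0) := cf j x Ux; exact.
have coordD x v : differentiable f x ->
    forall j, ('D_v f x) ord0 j = 'D_v (fun x => f x ord0 j) x.
  by move=> dfx j; rewrite derive_mx ?mxE//; exact: diff_derivable.
split=> [[df Df] j|cf].
  split=> [x Ux|v].
    apply: (@differentiable_comp _ _ _ _ f (fun M : 'rV[R]_n => M ord0 j)).
      exact: df.
    exact: differentiable_coord.
  apply: Ck_on_eq ((IH _).1 (Df v) j) => // x Ux; exact/coordD/df.
have df x : U x -> differentiable f x.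
  move=> Ux; rewrite (_ : f = \sum_j (fun x => f x ord0 j *: delta_mx 0 j)).
    apply: differentiable_sum => j.
    by apply: differentiableZl; exact: (cf j).1.
  by apply/funext => y; rewrite fct_sumE [LHS]row_sum_delta.
split=> // v; apply/IH => j; apply: Ck_on_eq ((cf j).2 v) => // x Ux.
exact/esym/coordD/df.
Unshelve. all: by end_near. Qed.

Lemma Ck_on_comp k V m (U : set V) (U' : set 'rV[R]_m)
    (f : V -> 'rV[R]_m) (g : 'rV[R]_m -> R) : open U ->
  U `<=` f @^-1` U' ->
  Ck_on k U f -> Ck_on k U' g -> Ck_on k U (g \o f).
Proof.
move=> oU sU; elim: k g => [|k IH] g.
  move=> cf cg x Ux; apply: continuous_comp; first exact: cf.
  exact/cg/sU.
move=> cf cg; have [[df Df] [dg Dg]] := (cf, cg).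
split=> [x Ux|v].
  by apply: differentiable_comp; [exact: df|exact/dg/sU].
apply: (@Ck_on_eq _ _ _ _
  (fun x => \sum_j ('D_v f x) ord0 j * ('D_(delta_mx 0 j) g \o f) x)) => //.
  move=> x Ux; have dfx := df x Ux; have dgx := dg _ (sU x Ux).
  have -> : 'D_v (g \o f) x = 'd g (f x) ('D_v f x).
    by rewrite !deriveE//; [rewrite diff_comp|exact: differentiable_comp].
  rewrite [X in _ = 'd g _ X]row_sum_delta linear_sum.
  by apply: eq_bigr => j _; rewrite linearZ_LR -deriveE.
apply: Ck_on_sum => // j; apply: Ck_onM => //.
  exact: ((Ck_on_coord k _ oU).1 (Df v) j).
exact: IH (Ck_onW cf) (Dg _).
Qed.

Lemma smooth_on_comp V m n (U : set V) (U' : set 'rV[R]_m)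
    (f : V -> 'rV[R]_m) (g : 'rV[R]_m -> 'rV[R]_n) : open U -> open U' ->
  U `<=` f @^-1` U' ->
  smooth_on U f -> smooth_on U' g -> smooth_on U (g \o f).
Proof.
move=> oU oU' sU cf cg k; apply/Ck_on_coord => // j.
apply: (@Ck_on_comp k _ _ _ U' f (fun x => g x ord0 j)) => //.
exact: ((Ck_on_coord k _ oU').1 (cg k) j).
Qed.

Lemma smooth_on_id V (U : set V) : smooth_on U id.
Proof.
case=> [|k]; first by move=> x Ux; exact: cvg_id.
split=> [x Ux|v]; first exact: (@ex_diff _ _ _ _ _ id id).
rewrite (_ : 'D_v _ = fun=> v); first exact: Ck_on_cst.
by apply/funext => x; rewrite derive_id.
Qed.

End Ck.

Section Manifold.
Context {R : realType}.

(* Outside chart_dom (resp. chart_cod) the values of chart_map (resp.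
   chart_inv) are irrelevant. On the empty space there is no chart, which is
   harmless as the empty atlas covers it. *)
Record chart (M : topologicalType) (d : nat) := Chart {
  chart_dom : set M;
  chart_cod : set 'rV[R]_d;
  chart_map : M -> 'rV[R]_d;
  chart_inv : 'rV[R]_d -> M;
  chart_dom_open : open chart_dom;
  chart_cod_open : open chart_cod;
  chart_mapP : forall x, chart_dom x -> chart_cod (chart_map x);
  chart_invP : forall y, chart_cod y -> chart_dom (chart_inv y);
  chart_mapK : forall x, chart_dom x -> chart_inv (chart_map x) = x;
  chart_invK : forall y, chart_cod y -> chart_map (chart_inv y) = y;
  chart_map_cont : forall x, chart_dom x -> {for x, continuous chart_map};
  chart_inv_cont : forall y, chart_cod y -> {for y, continuous chart_inv}
}.

Definition smooth_in_charts {M N : topologicalType} {m n : nat}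
    (c : chart M m) (c' : chart N n) (f : M -> N) : Prop :=
  smooth_on (chart_cod c `&` (f \o chart_inv c) @^-1` chart_dom c')
            (chart_map c' \o f \o chart_inv c).

Definition chart_compat {M : topologicalType} {d : nat} (c c' : chart M d) :
    Prop :=
  smooth_in_charts c c' id /\ smooth_in_charts c' c id.

Record manifold := Manifold {
  mfd_space :> topologicalType;
  mfd_dim : nat;
  mfd_hausdorff : hausdorff_space mfd_space;
  mfd_second_countable : @second_countable mfd_space;
  mfd_atlas : set (chart mfd_space mfd_dim);
  mfd_atlas_cover : forall x, exists2 c, mfd_atlas c & chart_dom c x;
  mfd_atlas_compat : forall c c', mfd_atlas c -> mfd_atlas c' ->
    chart_compat c c';
  mfd_atlas_maximal : forall c,
    (forall c', mfd_atlas c' -> chart_compat c c') -> mfd_atlas c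
}.

Definition smooth_map {M N : manifold} (f : M -> N) : Prop :=
  continuous f /\
  forall c c', mfd_atlas c -> mfd_atlas c' -> smooth_in_charts c c' f.

Lemma chart_reading_open {M N : topologicalType} {m : nat} (c : chart M m)
    (f : M -> N) (U : set N) : continuous f -> open U ->
  open (chart_cod c `&` (f \o chart_inv c) @^-1` U).
Proof.
move=> cf oU; rewrite openE => y [cy Uy].
apply: filterI.
  by apply: open_nbhs_nbhs; split=> //; exact: chart_cod_open.
have : {for y, continuous (f \o chart_inv c)}.
  by apply: continuous_comp; [exact: chart_inv_cont|exact: cf].
by apply; apply: open_nbhs_nbhs.
Qed.

Lemma smooth_in_charts_comp {M N L : topologicalType} {m n l : nat}
    (c : chart M m) (c'' : chart L l) (f : M -> N) (g : N -> L) :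
  continuous f -> continuous g ->
  (forall z, exists2 c' : chart N n, chart_dom c' z &
     smooth_in_charts c c' f /\ smooth_in_charts c' c'' g) ->
  smooth_in_charts c c'' (g \o f).
Proof.
move=> cf cg H k; apply: Ck_on_local => y [cy gy].
have [c' c'y [sf sg]] := H (f (chart_inv c y)).
set A := chart_cod c `&` (f \o chart_inv c) @^-1` chart_dom c'.
set B := chart_cod c `&` ((g \o f) \o chart_inv c) @^-1` chart_dom c''.
have oA : open A by apply: chart_reading_open => //; exact: chart_dom_open.
have cgf : continuous (g \o f).
  by move=> x; apply: continuous_comp; [exact: cf|exact: cg].
have oB : open B by apply: chart_reading_open => //; exact: chart_dom_open.
have oAB : open (A `&` B) by exact: openI.
exists (A `&` B); first by [].
have oB' := @chart_reading_open _ _ _ c' g _ cg (chart_dom_open c'').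
have sub : A `&` B `<=` (chart_map c' \o f \o chart_inv c) @^-1`
    (chart_cod c' `&` (g \o chart_inv c') @^-1` chart_dom c'').
  move=> x [[_ Ax] [_ Bx]] /=; split; first exact: chart_mapP.
  by rewrite /= chart_mapK.
have sfAB : smooth_on (A `&` B) (chart_map c' \o f \o chart_inv c).
  by move=> j; apply: Ck_on_sub (sf j) => x [].
apply: Ck_on_eq (smooth_on_comp oAB oB' sub sfAB sg k) => //.
by move=> x [[_ Ax] _] /=; rewrite chart_mapK.
Qed.

Lemma smooth_map_id (M : manifold) : smooth_map (id : M -> M).
Proof.
split; first by move=> x; exact: cvg_id.
by move=> c c' Mc Mc'; have [] := mfd_atlas_compat Mc Mc'.
Qed.

Lemma smooth_map_comp (M N L : manifold) (f : M -> N) (g : N -> L) :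
  smooth_map f -> smooth_map g -> smooth_map (g \o f).
Proof.
move=> [cf sf] [cg sg]; split.
  by move=> x; apply: continuous_comp; [exact: cf|exact: cg].
move=> c c'' Mc Lc''; apply: (@smooth_in_charts_comp _ _ _ _ (mfd_dim N)) => //.
move=> z; have [c' Nc' c'z] := mfd_atlas_cover z.
by exists c' => //; split; [exact: sf|exact: sg].
Qed.

Section Euclidean.
Variable n : nat.

Lemma rV_second_countable : @second_countable 'rV[R]_n.
Proof.
pose F (p : 'rV[rat]_n * nat) : set 'rV[R]_n :=
  ball (map_mx ratr p.1 : 'rV[R]_n) (p.2.+1%:R^-1).
exists (range F).
  by apply: card_le_trans (card_image_le F setT) _; exact: countableP.
split; first by move=> _ [p _ <-]; exact: ball_open.
move=> x A /nbhs_ballP[e /= e0 xA].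
have e2 : 0 < e / 2 by rewrite divr_gt0.
have [k _ /(_ k (leqnn k)) /= ke] := near_infty_natSinv_lt (PosNum e2).
set d : R := k.+1%:R^-1 in ke; have d0 : 0 < d by rewrite invr_gt0.
have /choice[q Hq] : forall j, exists r : rat, `|ratr r - x ord0 j| < d.
  move=> j; have /rat_in_itvoo[r] : x ord0 j - d < x ord0 j + d.
    by rewrite ltrBlDr -addrA ltrDl addr_gt0.
  rewrite in_itv/= => /andP[r1 r2]; exists r.
  by rewrite ltr_norml ltrBrDl r1/= ltrBlDl.
pose Q := \row_j q j.
have Qx : ball (map_mx ratr Q : 'rV[R]_n) d x.
  rewrite -ball_normE/= /Num.Def.normr/= mx_normrE.
  apply/bigmax_ltP; split=> // -[i j] _ /=.
  by rewrite ord1 !mxE; exact: Hq.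
exists (ball (map_mx ratr Q : 'rV[R]_n) d); first by split=> //; exists (Q, k).
move=> y Qy; apply: xA; apply: (@le_ball _ _ _ (d + d)).
  by rewrite (splitr e) lerD// ltW.
exact: ball_triangle (ball_sym Qx) Qy.
Qed.

Lemma continuous_at_id (T : topologicalType) (x : T) : {for x, continuous id}.
Proof. exact: cvg_id. Qed.

Definition euclidean_chart : chart 'rV[R]_n n :=
  @Chart 'rV[R]_n n setT setT id id openT openT (fun _ => id) (fun _ => id)
    (fun _ _ => erefl) (fun _ _ => erefl)
    (fun x _ => @continuous_at_id _ x) (fun x _ => @continuous_at_id _ x).

Definition euclidean_atlas : set (chart 'rV[R]_n n) :=
  [set c | chart_compat c euclidean_chart].

Lemma euclidean_atlas_std : euclidean_atlas euclidean_chart.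
Proof. by split; exact: smooth_on_id. Qed.

Lemma euclidean_atlas_compat c c' :
  euclidean_atlas c -> euclidean_atlas c' -> chart_compat c c'.
Proof.
move=> [c1 c2] [c'1 c'2].
by split; apply: (@smooth_in_charts_comp _ _ _ _ n _ _ _ id id);
  do ?[exact: (fun=> cvg_id)] => z; exists euclidean_chart.
Qed.

Definition euclidean : manifold :=
  @Manifold 'rV[R]_n n (@norm_hausdorff _ _) rV_second_countable euclidean_atlas
    (fun x => ex_intro2 _ _ euclidean_chart euclidean_atlas_std I)
    euclidean_atlas_compat
    (fun c H => H _ euclidean_atlas_std).

End Euclidean.
End Manifold.

Section Category.

Record category := Category {
  ob :> Type;
  hom : ob -> ob -> Type;
  idm : forall a, hom a a;
  comp : forall a b c, hom b c -> hom a b -> hom a c;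
  comp_idl : forall a b (f : hom a b), comp (idm b) f = f;
  comp_idr : forall a b (f : hom a b), comp f (idm a) = f;
  compA : forall a b c d (h : hom c d) (g : hom b c) (f : hom a b),
    comp h (comp g f) = comp (comp h g) f
}.

Record functor (C D : category) := Functor {
  fob :> C -> D;
  fmap : forall a b : C, hom a b -> hom (fob a) (fob b);
  fmap_id : forall a : C, fmap (idm a) = idm (fob a);
  fmap_comp : forall (a b c : C) (g : hom b c) (f : hom a b),
    fmap (comp g f) = comp (fmap g) (fmap f)
}.

Definition faithful (C D : category) (F : functor C D) : Prop :=
  forall (a b : C) (f g : hom a b), fmap F f = fmap F g -> f = g.

Definition full (C D : category) (F : functor C D) : Prop :=
  forall (a b : C) (h : hom (F a) (F b)), exists f : hom a b, fmap F f = h.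

Definition is_product (C : category) (I : Type) (X : I -> C) (P : C)
    (pi : forall i, hom P (X i)) : Prop :=
  forall (Q : C) (f : forall i, hom Q (X i)),
    exists! h : hom Q P, forall i, comp (pi i) h = f i.

Definition preserves_finite_products (C D : category) (F : functor C D) :
    Prop :=
  forall (I : finType) (X : I -> C) (P : C) (pi : forall i, hom P (X i)),
    is_product pi -> is_product (fun i => fmap F (pi i)).

End Category.

Lemma sval_inj (T : Type) (P : T -> Prop) : injective (@sval T P).
Proof. by move=> [x Px] [y Py] /=; exact: eq_exist. Qed.

Section ManifoldCategory.
Variable R : realType.

Program Definition Man : category := {|
  ob := @manifold R;
  hom M N := {f : M -> N | smooth_map f};
  idm M := exist _ id (smooth_map_id M);
  comp M N L g f := exist _ (sval g \o sval f) (smooth_map_comp (svalP f) (svalP g))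
|}.
Next Obligation. by move=> M N f; exact: sval_inj. Qed.
Next Obligation. by move=> M N f; exact: sval_inj. Qed.
Next Obligation. by move=> *; exact: sval_inj. Qed.

End ManifoldCategory.

(* M may be empty, hence no measurableType instance on it: sigma-algebras are
   handled as sets of sets. *)
Definition borel (T : topologicalType) : set (set T) := <<s @open T >>.

Definition measurable_wrt {X Y : Type} (SX : set (set X)) (SY : set (set Y))
    (f : X -> Y) : Prop :=
  forall B, SY B -> SX (f @^-1` B).

Section SampleSpace.
Variable R : realType.

Definition unit_interval : Type := set_type (`[0, 1]%classic : set R).

HB.instance Definition _ := Topological.on unit_interval.

Lemma unit_interval0_subproof : (0 : R) \in (`[0, 1]%classic : set R).
Proof. by rewrite inE/= in_itv/= lexx ler01. Qed.

HB.instance Definition _ :=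
  isPointed.Build unit_interval (exist _ 0 unit_interval0_subproof).

Definition Omega : Type := prod_topology (fun _ : nat => unit_interval).

HB.instance Definition _ := Topological.on Omega.

(* A lies in the P-completion of the Borel sigma-algebra for every Borel
   probability P; finite measures would give the same sets. *)
Definition universally_measurable : set (set Omega) :=
  [set A | forall P : probability (g_sigma_algebraType (@open Omega)) R,
     exists B C : set (g_sigma_algebraType (@open Omega)),
       [/\ measurable B, measurable C, B `<=` A, A `<=` C & P (C `\` B) = 0%E]].

Definition sample_endo (Phi : Omega -> Omega) : Prop :=
  measurable_wrt universally_measurable universally_measurable Phi.

Definition Omega_ (n : nat) : Type := ('rV[R]_n * Omega)%type.

Definition mixed_smooth {m n : nat} (g : Omega_ m -> 'rV[R]_n) : Prop :=
  (forall w, smooth_on setT (fun t => g (t, w))) /\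
  (forall t, measurable_wrt universally_measurable (@borel 'rV[R]_n)
               (fun w => g (t, w))).

Definition site_hom {m n : nat} (h : Omega_ m -> Omega_ n) : Prop :=
  exists (g : Omega_ m -> 'rV[R]_n) (Phi : Omega -> Omega),
    [/\ mixed_smooth g, sample_endo Phi & h = fun x => (g x, Phi x.2)].

Definition plot_family (X : Type) : Type := forall n, set (Omega_ n -> X).

Record is_sample_smooth {X : Type} (p : plot_family X) : Prop := {
  plot_cst : forall n (x : X), p n (fun=> x);
  plot_comp : forall m n (q : Omega_ n -> X) (h : Omega_ m -> Omega_ n),
    p n q -> site_hom h -> p m (q \o h)
}.

Definition sample_smooth_map {X Y : Type} (p : plot_family X)
    (q : plot_family Y) (f : X -> Y) : Prop :=
  forall n (c : Omega_ n -> X), p n c -> q n (f \o c).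

Record sample_smooth_space := SampleSmoothSpace {
  sss_carrier :> Type;
  sss_plots : plot_family sss_carrier;
  sss_plotsP : is_sample_smooth sss_plots
}.

Lemma sample_smooth_map_id {X : Type} (p : plot_family X) :
  sample_smooth_map p p id.
Proof. by []. Qed.

Lemma sample_smooth_map_comp {X Y Z : Type} (p : plot_family X)
    (q : plot_family Y) (r : plot_family Z) (f : X -> Y) (g : Y -> Z) :
  sample_smooth_map p q f -> sample_smooth_map q r g ->
  sample_smooth_map p r (g \o f).
Proof. by move=> sf sg n c /sf/sg. Qed.

Program Definition SSS : category := {|
  ob := sample_smooth_space;
  hom X Y := {f : X -> Y | sample_smooth_map (@sss_plots X) (@sss_plots Y) f};
  idm X := exist _ id (@sample_smooth_map_id X (@sss_plots X));
  comp X Y Z g f :=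
    exist _ (sval g \o sval f) (sample_smooth_map_comp (svalP f) (svalP g))
|}.
Next Obligation. by move=> X Y f; exact: sval_inj. Qed.
Next Obligation. by move=> X Y f; exact: sval_inj. Qed.
Next Obligation. by move=> *; exact: sval_inj. Qed.

Section Product.
Variables (I : Type) (X : I -> sample_smooth_space).

Definition sss_prod_plots : plot_family (forall i, X i) :=
  fun n => [set c | forall i, @sss_plots (X i) n (fun x => c x i)].

Lemma sss_prod_plotsP : is_sample_smooth sss_prod_plots.
Proof.
split=> [n x i|m n q h pq hh i]; first exact: plot_cst (sss_plotsP (X i)) _ _.
exact: plot_comp (sss_plotsP (X i)) _ _ _ _ (pq i) hh.
Qed.

Definition sss_prod : sample_smooth_space := SampleSmoothSpace sss_prod_plotsP.

Lemma sss_proj_subproof i :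
  sample_smooth_map (@sss_plots sss_prod) (@sss_plots (X i)) (fun x => x i).
Proof. by move=> n c; exact. Qed.

Definition sss_proj i : @hom SSS sss_prod (X i) :=
  exist _ (fun x => x i) (sss_proj_subproof i).

Lemma sss_prod_is_product : @is_product SSS I X sss_prod sss_proj.
Proof.
move=> Q f.
have sf : sample_smooth_map (@sss_plots Q) (@sss_plots sss_prod)
    (fun x i => sval (f i) x).
  by move=> n c Qc i; exact: (svalP (f i)) _ _ Qc.
exists (exist _ _ sf); split=> [i|h hf]; first exact: sval_inj.
apply: sval_inj; apply/funext => x; apply/functional_extensionality_dep => i.
by rewrite /= -(hf i).
Qed.

End Product.

Definition manifold_plots (M : @manifold R) : plot_family M :=
  fun n => [set p : Omega_ n -> M |
    (forall w, @smooth_map R (euclidean n) M (fun t => p (t, w))) /\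
    (forall t, measurable_wrt universally_measurable (@borel M)
                 (fun w => p (t, w)))].

Program Definition manifold_functor
    (Hob : forall M : @manifold R, is_sample_smooth (@manifold_plots M))
    (Hmor : forall (M N : @manifold R) (f : M -> N), smooth_map f ->
       sample_smooth_map (@manifold_plots M) (@manifold_plots N) f) :
    functor (Man R) SSS := {|
  fob M := SampleSmoothSpace (Hob M) : SSS;
  fmap M N f := exist _ (sval f) (Hmor M N (sval f) (svalP f))
|}.
Next Obligation. by move=> *; exact: sval_inj. Qed.
Next Obligation. by move=> *; exact: sval_inj. Qed.

End SampleSpace.

(* Main.v *)
From HB Require Import structures.
Require Import Defs.
From mathcomp Require Import all_boot all_order all_algebra.
From mathcomp Require Import all_classical all_reals all_analysis.
From mathcomp Require Import ring.

(** The two structure conditions reduce to Carathéodory functions: a plot [p] is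
    continuous in its parameter and measurable in the sample, and pulling it back
    along a site morphism [(g, Phi)] yields [w |-> p (g (t, w), Phi w)]. Manifolds
    are regular and second countable, so such a composite is universally measurable
    ([caratheodory_comp], [manifold_plots_sample_smooth]).

    The functor is the identity on underlying maps, hence faithful. For fullness,
    a smooth map from a Euclidean space to [M] is a plot that does not depend on the
    sample. Composition with a coordinatewise arctangent turns charts into local
    parametrizations of [M] by a whole Euclidean space with a smooth local inverse
    ([local_parametrization]). A sample-smooth map becomes smooth after composition
    with each of these, hence is smooth ([smooth_map_detect]).

    For products, no model of the product manifold is constructed: what matters about
    a product [P] follows from its universal property. Testing against a point
    identifies the points of [P] with families of points of the factors
    ([manifold_product_ext]); testing against Euclidean spaces shows that a map to
    [P] with smooth components is smooth ([manifold_product_lift]); testing against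
    the product of the model spaces shows that [P] has the initial topology of its
    projections ([manifold_product_nbhs]). As the factors are second countable, the
    Borel sets of [P] are then generated by preimages of Borel sets of the factors,
    so a map to [P] with measurable components is measurable
    ([manifold_product_measurable]). Thus the plots of [P] are exactly the families
    of plots of the factors. *)

Set Implicit Arguments.
Unset Strict Implicit.
Unset Printing Implicit Defensive.

Import Order.TTheory GRing.Theory Num.Theory.
Import numFieldNormedType.Exports.

Local Open Scope classical_set_scope.
Local Open Scope ring_scope.

(** * Smooth functions of one real variable *)

Section Calculus.
Context {R : realType}.

Lemma derive_real (g : R -> R) (x v a : R) :
  is_derive x 1 g a -> 'D_v g x = v * a.
Proof.
move=> gx; have dg : differentiable g x by apply/derivable1_diffP; exact: ex_derive.
by rewrite deriveE// diff1E// derive1E derive_val.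
Qed.

Lemma Ck_on_real k (U : set R) (g g' : R -> R) : open U ->
  (forall x, U x -> is_derive x 1 g (g' x)) -> Ck_on k U g' -> Ck_on k.+1 U g.
Proof.
move=> oU dg cg'; split=> [x /dg gx|v].
  by apply/derivable1_diffP; exact: ex_derive.
apply: (@Ck_on_eq _ _ _ _ _ (fun x => v * g' x)) => //.
  by move=> x /dg gx; rewrite (derive_real _ gx).
by apply: Ck_onM => //; exact: Ck_on_cst.
Qed.

Lemma continuous_on_real (U : set R) (g g' : R -> R) :
  (forall x, U x -> is_derive x 1 g (g' x)) -> Ck_on 0 U g.
Proof.
by move=> dg x /dg gx; apply: differentiable_continuous; apply/derivable1_diffP.
Qed.

(** The derivative of [g \o f] is [g' \o f] times that of [f], so one further
    derivative of the composite costs one further derivative of each factor. *)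
Lemma smooth_on_comp_scalar (V : normedModType R) (U : set V) (U' : set R)
    (f : V -> R) (g : R -> R) : open U -> U `<=` f @^-1` U' ->
  smooth_on U f -> smooth_on U' g -> smooth_on U (g \o f).
Proof.
move=> oU sU cf; move=> + k; elim: k g => [|k IH] g cg.
  by move=> x Ux; apply: continuous_comp; [exact: (cf 0%N)|exact/(cg 0%N)/sU].
have [[df Df] [dg _]] := (cf 1%N, cg 1%N).
split=> [x Ux|v]; first by apply: differentiable_comp; [exact: df|exact/dg/sU].
apply: (@Ck_on_eq _ _ _ _ _ (fun x => 'D_v f x * ('D_1 g \o f) x)) => //.
  move=> x Ux; have dfx := df x Ux; have dgx := dg _ (sU x Ux).
  have dgf : differentiable (g \o f) x by exact: differentiable_comp.
  rewrite (deriveE _ dgf) diff_comp//= -(deriveE _ dfx) -derive1E.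
  by rewrite diff1E.
apply: Ck_onM => //; first exact: (cf k.+1).2.
apply: IH => j; exact: (cg j.+1).2.
Qed.

(** The equation tan' = 1 + tan * tan has a right-hand side that is polynomial in
    tan, so tan is as differentiable as its own derivative. *)
Lemma smooth_on_tan : smooth_on `](- (pi / 2)), (pi / 2)[%classic (@tan R).
Proof.
set U := `]_, _[%classic.
have oU : open U by exact: interval_open.
have dtan (x : R) : U x -> is_derive x 1 (@tan R) (1 + tan x * tan x).
  move=> Ux; have cx : cos x != 0.
    by rewrite lt0r_neq0// cos_gt0_pihalf//; move: Ux; rewrite /U/= in_itv.
  by rewrite -expr2 -cos2_tan2//; exact: is_derive_tan.
elim=> [|k IH]; first exact: continuous_on_real dtan.
apply: Ck_on_real dtan _ => //.
by apply: Ck_onD => //; [exact: Ck_on_cst|exact: Ck_onM].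
Qed.

(** The derivative [w x = (1 + x * x)^-1] satisfies w' = - 2 x w^2, which is
    polynomial in x and w and can thus be bootstrapped like tan. *)
Lemma smooth_on_atan : smooth_on setT (@atan R).
Proof.
pose w (x : R) := (1 + x * x)^-1.
have w0 x : 1 + x * x != 0 :> R by rewrite lt0r_neq0// ltr_pwDl// -expr2 sqr_ge0.
have dw (x : R) : is_derive x (1 : R) w (- 2 * (x * (w x * w x))).
  apply: is_derive_eq; first by apply: is_deriveV.
  by rewrite /w/= /GRing.scale/=; field.
have sw : smooth_on setT w.
  elim=> [|k IH]; first by apply: continuous_on_real => x _; exact: dw.
  apply: Ck_on_real (fun x _ => dw x) _; first exact: openT.
  apply: Ck_onM; [exact: openT|exact: Ck_on_cst|].
  apply: Ck_onM; [exact: openT|exact: smooth_on_id|].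
  by apply: Ck_onM; first exact: openT.
have da (x : R) : is_derive x (1 : R) (@atan R) (w x).
  by rewrite /w -expr2; exact: is_derive1_atan.
case=> [|k]; first by apply: continuous_on_real => x _; exact: da.
by apply: Ck_on_real (fun x _ => da x) _ => //; exact: openT.
Qed.

End Calculus.

(** * Local criteria for smoothness on manifolds *)

Section ManifoldLemmas.
Context {R : realType}.

Lemma smooth_on_sub (V W : normedModType R) (U U' : set V) (f : V -> W) :
  U' `<=` U -> smooth_on U f -> smooth_on U' f.
Proof. by move=> sU sf k; exact: Ck_on_sub (sf k). Qed.

Lemma smooth_on_eq (V W : normedModType R) (U : set V) (f g : V -> W) :
  open U -> (forall x, U x -> f x = g x) -> smooth_on U f -> smooth_on U g.
Proof. by move=> oU fg sf k; exact: Ck_on_eq (sf k). Qed.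

Lemma smooth_on_rowP (V : normedModType R) n (U : set V) (f : V -> 'rV[R]_n) :
  open U -> (forall j, smooth_on U (fun x => f x ord0 j)) -> smooth_on U f.
Proof. by move=> oU sf k; apply/Ck_on_coord => // j; exact: sf. Qed.

Lemma smooth_on_coord n (U : set 'rV[R]_n) j : open U ->
  smooth_on U (fun x => x ord0 j).
Proof. by move=> oU k; apply: (Ck_on_coord k id oU).1 j; exact: smooth_on_id. Qed.

Lemma open_preimage_on (T S : topologicalType) (A : set T) (B : set S)
    (f : T -> S) : open A -> open B ->
  (forall x, A x -> {for x, continuous f}) -> open (A `&` f @^-1` B).
Proof.
move=> oA oB cf; rewrite openE => x [Ax Bfx]; apply: filterI.
  exact: open_nbhs_nbhs.
by apply: (cf x Ax); exact: open_nbhs_nbhs.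
Qed.

Lemma rV_ballP n (x y : 'rV[R]_n) (e : R) : 0 < e ->
  ball x e y <-> forall j, `|x ord0 j - y ord0 j| < e.
Proof.
move=> e0; rewrite -ball_normE/= /Num.Def.normr/= mx_normrE; split.
  by move=> /bigmax_ltP[_ H] j; have := H (ord0, j) isT; rewrite !mxE.
by move=> H; apply/bigmax_ltP; split=> // -[i j] _ /=; rewrite ord1 !mxE; exact: H.
Qed.

(** Every point of a Euclidean space has arbitrarily small neighbourhoods
    parametrized smoothly by the whole space: apply atan in each coordinate and
    shrink. The inverse is only claimed on a smaller cube [B]. *)
Lemma cube_parametrization n (y0 : 'rV[R]_n) (U : set 'rV[R]_n) : nbhs y0 U ->
  exists (phi psi : 'rV[R]_n -> 'rV[R]_n) (B : set 'rV[R]_n),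
  [/\ open B /\ B y0, smooth_on setT phi, forall t, U (phi t), smooth_on B psi
    & forall y, B y -> phi (psi y) = y].
Proof.
move=> /nbhs_ballP[e /= e0 eU].
have p0 : 0 < pi :> R := pi_gt0 R.
have p2 : 1 <= pi / 2 :> R by rewrite ler_pdivlMr// mul1r pi_ge2.
(* The values of s * atan stay within s * (pi / 2) = e / 2. *)
pose s := e / pi; have s0 : 0 < s by rewrite divr_gt0.
exists (fun t => \row_j (y0 ord0 j + s * atan (t ord0 j))).
exists (fun y => \row_j tan (s^-1 * (y ord0 j - y0 ord0 j))).
(* On this ball the argument of tan stays in ]-1, 1[, where tan inverts atan,
   because 1 <= pi / 2. *)
exists (ball y0 s).
have inI y : ball y0 s y -> forall j,
    `](- (pi / 2)), (pi / 2)[%classic (s^-1 * (y ord0 j - y0 ord0 j)).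
  move=> /(rV_ballP _ _ s0) By j /=; rewrite in_itv/= -ltr_norml.
  rewrite normrM gtr0_norm ?invr_gt0// mulrC ltr_pdivrMr// distrC.
  by rewrite (lt_le_trans (By j))// ler_peMl// ltW.
split; first by split; [exact: ball_open|exact: ballxx].
- apply: smooth_on_rowP => [|j k]; first exact: openT.
  under eq_fun do rewrite mxE.
  apply: Ck_onD; [exact: openT|exact: Ck_on_cst|].
  apply: Ck_onM; [exact: openT|exact: Ck_on_cst|].
  apply: (@smooth_on_comp_scalar _ _ setT setT (fun t : 'rV[R]_n => t ord0 j)).
  - exact: openT.
  - by [].
  - by apply: smooth_on_coord; exact: openT.
  - exact: smooth_on_atan.
- move=> t; apply: eU; apply/rV_ballP => // j; rewrite mxE opprD addNKr normrN.
  rewrite normrM gtr0_norm// mulrAC ltr_pdivrMr// ltr_pM2l//.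
  rewrite (@lt_trans _ _ (pi / 2))//; last by rewrite gtr_pMr// invf_lt1// ltr1n.
  by rewrite ltr_norml atan_gtNpi2 atan_ltpi2.
- have oB : open (ball y0 s) by exact: ball_open.
  apply: smooth_on_rowP => // j; under eq_fun do rewrite mxE.
  apply: (@smooth_on_comp_scalar _ _ _ `](- (pi / 2)), (pi / 2)[%classic
    (fun y : 'rV[R]_n => s^-1 * (y ord0 j - y0 ord0 j))) => //.
  - by move=> y By; exact: inI.
  - move=> k; apply: Ck_onM => //; first exact: Ck_on_cst.
    apply: Ck_onD => //; last exact: Ck_on_cst.
    exact: smooth_on_coord.
  - exact: smooth_on_tan.
- move=> y By; apply/rowP => j; rewrite !mxE tanK; last exact: (inI y By j).
  by rewrite mulrA divff ?mul1r ?subrKC// gt_eqF.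
Qed.

(** It suffices to find, around each point, one pair of charts that reads [f]
    smoothly on some open set [W]: the readings in all other charts differ from it
    by transition maps. *)
Lemma smooth_map_local (M N : @manifold R) (f : M -> N) : continuous f ->
  (forall x, exists c c' W, [/\ mfd_atlas c /\ chart_dom c x, @mfd_atlas R N c',
     open W /\ W (chart_map c x),
     W `<=` chart_cod c `&` (f \o chart_inv c) @^-1` chart_dom c' &
     smooth_on W (chart_map c' \o f \o chart_inv c)]) ->
  smooth_map f.
Proof.
move=> cf H; split=> // c1 c1' Mc1 Nc1' k; apply: Ck_on_local => y [c1y fy].
have [c [c' [W [[Mc cx] Nc' [oW Wx] subW sW]]]] := H (chart_inv c1 y).
have [c1c _] := mfd_atlas_compat Mc1 Mc.
have [c'c1' _] := mfd_atlas_compat Nc' Nc1'.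
set W2 := W `&` (chart_cod c `&` (f \o chart_inv c) @^-1` chart_dom c1').
have oW2 : open W2.
  by apply: openI => //; apply: chart_reading_open => //; exact: chart_dom_open.
have oD : open (chart_dom c `&` chart_map c @^-1` W2).
  apply: open_preimage_on => //; first exact: chart_dom_open.
  by move=> x; exact: chart_map_cont.
(* [V] is the part of the chart [c1] on which all three factors [A], [B], [C] of
   the reading of [f] in [c1] and [c1'] make sense. *)
set V := chart_cod c1 `&` (id \o chart_inv c1) @^-1`
  (chart_dom c `&` chart_map c @^-1` W2).
have oV : open V by apply: chart_reading_open => // x; exact: cvg_id.
exists V.
  split=> //; split=> //=; split=> //; split; first exact: chart_mapP.
  by rewrite /= chart_mapK.
pose A := chart_map c \o id \o chart_inv c1.
pose B := chart_map c' \o f \o chart_inv c.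
pose C := chart_map c1' \o id \o chart_inv c'.
apply: (@Ck_on_eq _ _ _ _ _ (C \o (B \o A))) => //.
  move=> z [_ [/= cz [Wz _]]]; rewrite /A /B /C /= (chart_mapK cz).
  have [_ /=] := subW _ Wz; rewrite (chart_mapK cz) => c'z.
  by rewrite (chart_mapK c'z).
apply: (@smooth_on_comp _ _ _ _ _ (chart_cod c' `&` (id \o chart_inv c') @^-1`
    chart_dom c1')) => //.
- apply: chart_reading_open; last exact: chart_dom_open.
  by move=> x; exact: cvg_id.
- move=> z [_ [/= cz [Wz [_ Hz]]]]; rewrite /A /B /=.
  have [_ /=] := subW _ Wz => c'z; split; first exact: chart_mapP.
  by rewrite /= (chart_mapK c'z).
- apply: (@smooth_on_comp _ _ _ _ _ W2) => //.
  + by move=> z [_ []].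
  + by apply: smooth_on_sub c1c => z [? [? _]].
  + by apply: smooth_on_sub sW => z [].
Qed.

Lemma smooth_map_cst (M N : @manifold R) (a : N) :
  smooth_map (fun=> a : N) (M := M).
Proof.
have ca : continuous (fun _ : M => a) by exact: cst_continuous.
apply: smooth_map_local => // x.
have [c Mc cx] := mfd_atlas_cover x; have [c' Nc' c'a] := mfd_atlas_cover a.
exists c, c', (chart_cod c); split=> //.
- by split; [exact: chart_cod_open|exact: chart_mapP].
- by move=> k; exact: Ck_on_cst.
Qed.

Lemma smooth_map_from_euclidean n (N : @manifold R) (f : 'rV[R]_n -> N) :
  continuous f ->
  (forall x, exists c' W, [/\ @mfd_atlas R N c', open W /\ W x,
     W `<=` f @^-1` chart_dom c' & smooth_on W (chart_map c' \o f)]) ->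
  @smooth_map R (euclidean n) N f.
Proof.
move=> cf H; apply: smooth_map_local => // x; have [c' [W [Nc' Wx sW sf]]] := H x.
exists (euclidean_chart n), c', W; split=> //.
  by split=> //; exact: euclidean_atlas_std.
by move=> z Wz; split=> //; exact: sW.
Qed.

Lemma smooth_map_euclidean m n (f : 'rV[R]_m -> 'rV[R]_n) :
  smooth_on setT f -> @smooth_map R (euclidean m) (euclidean n) f.
Proof.
move=> sf; apply: smooth_map_from_euclidean.
  by move=> x; exact: (sf 0%N).
move=> x; exists (euclidean_chart n), setT; split=> //.
  exact: euclidean_atlas_std.
by split=> //; exact: openT.
Qed.

(** The map [phi] is defined on a full Euclidean space, which is what makes it a
    plot; [psi] recovers its parameter near [x]. *)
Lemma local_parametrization (M : @manifold R) (x : M) :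
  exists (c : chart M (mfd_dim M)) (phi : 'rV[R]_(mfd_dim M) -> M)
    (psi : 'rV[R]_(mfd_dim M) -> 'rV[R]_(mfd_dim M)) B,
  [/\ mfd_atlas c /\ chart_dom c x,
      [/\ open B, B (chart_map c x) & B `<=` chart_cod c],
      @smooth_map R (euclidean (mfd_dim M)) M phi, smooth_on B psi &
      forall y, B y -> phi (psi y) = chart_inv c y].
Proof.
have [c Mc cx] := mfd_atlas_cover x.
have [|phi [psi [B [[oB Bx] sphi phiU spsi phiK]]]] :=
    @cube_parametrization _ (chart_map c x) (chart_cod c).
  by apply: open_nbhs_nbhs; split; [exact: chart_cod_open|exact: chart_mapP].
exists c, (chart_inv c \o phi), psi, B; split=> //.
- by split=> // y By; rewrite -(phiK _ By).
- apply: smooth_map_from_euclidean.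
    move=> t; apply: continuous_comp; first exact: (sphi 0%N).
    exact: chart_inv_cont.
  move=> t; exists c, setT; split=> //; first by split=> //; exact: openT.
    by move=> u _; exact: chart_invP.
  apply: smooth_on_eq sphi; first exact: openT.
  by move=> u _ /=; rewrite chart_invK.
- by move=> y By /=; rewrite phiK.
Qed.

Lemma near_eq_continuous (T S : topologicalType) (f g : T -> S) (x : T) :
  (\near x, f x = g x) -> {for x, continuous f} -> {for x, continuous g}.
Proof.
move=> fg cf; have : f y @[y --> x] --> g x by rewrite -(nbhs_singleton fg).
by apply: cvg_trans; exact: near_eq_cvg.
Qed.

Lemma chart_near (M : topologicalType) d (c : @chart R M d) (B : set 'rV[R]_d)
    (x : M) : chart_dom c x -> nbhs (chart_map c x) B ->
  \near x, chart_dom c x /\ B (chart_map c x).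
Proof.
move=> cx Bx; apply: filterI; last exact: chart_map_cont Bx.
by apply: open_nbhs_nbhs; split=> //; exact: chart_dom_open.
Qed.

(** Near a point, [h] is the composite of [h \o phi], smooth by assumption for a
    local parametrization [phi], and of the smooth inverse of [phi]. Even the
    continuity of [h] comes out of this factorization. *)
Lemma smooth_map_detect (M N : @manifold R) (h : M -> N) :
  (forall p, @smooth_map R (euclidean (mfd_dim M)) M p ->
     @smooth_map R (euclidean (mfd_dim M)) N (h \o p)) ->
  smooth_map h.
Proof.
move=> H.
have ch : continuous h.
  move=> x; have [c [phi [psi [B [[_ cx] [oB Bx _] sphi spsi phiK]]]]] :=
    local_parametrization x.
  have [chphi _] := H _ sphi.
  apply: (@near_eq_continuous _ _ ((h \o phi) \o (psi \o chart_map c))).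
    apply: filterS (chart_near cx (open_nbhs_nbhs (conj oB Bx))) => z [cz Bz] /=.
    by rewrite phiK// chart_mapK.
  apply: continuous_comp; last exact: chphi.
  apply: continuous_comp; first exact: chart_map_cont.
  exact: (spsi 0%N).
apply: smooth_map_local => // x.
have [c [phi [psi [B [[Mc cx] [oB Bx sB] sphi spsi phiK]]]]] :=
  local_parametrization x.
have [c' Nc' c'x] := mfd_atlas_cover (h x).
have [chphi /(_ _ _ (euclidean_atlas_std _) Nc') shphi] := H _ sphi.
pose O := chart_cod (@euclidean_chart R (mfd_dim M)) `&`
  ((h \o phi) \o chart_inv (euclidean_chart _)) @^-1` chart_dom c'.
have oO : open O.
  apply: (@chart_reading_open _ _ _ _ (euclidean_chart _) (h \o phi)) => //.
  exact: chart_dom_open.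
have oBO : open (B `&` psi @^-1` O).
  by apply: open_preimage_on => //; exact: (spsi 0%N).
exists c, c', (B `&` psi @^-1` O); split=> //.
- by split=> //; split=> //; split=> //=; rewrite phiK// chart_mapK.
- by move=> y [By [_ /=]]; rewrite phiK// => Dy; split=> //; exact: sB.
- apply: (@smooth_on_eq _ _ _ ((chart_map c' \o (h \o phi)) \o psi)) => //.
    by move=> y [By _] /=; rewrite phiK.
  apply: (@smooth_on_comp _ _ _ _ _ O) => //.
  by apply: smooth_on_sub spsi => y [].
Qed.

(** Manifolds are locally compact and Hausdorff. *)
Lemma manifold_regular (M : @manifold R) : @regular_space M.
Proof.
move=> x; have [c Mc cx] := mfd_atlas_cover x.
have /nbhs_closedballP[e eC] : nbhs (chart_map c x) (chart_cod c).
  by apply: open_nbhs_nbhs; split; [exact: chart_cod_open|exact: chart_mapP].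
set K := closed_ball _ _ in eC.
have cK : compact K.
  apply: bounded_closed_compact; last exact: closed_ball_closed.
  exists (`|chart_map c x| + e%:num); split=> [|B HB y]; first exact: num_real.
  rewrite /K closed_ballE// /closed_ball_/= distrC => ye; apply: ltW.
  apply: le_lt_trans HB; rewrite -{1}(subrK (chart_map c x) y) addrC.
  by rewrite (le_trans (ler_normD _ _))// lerD2l.
apply: (@compact_regular _ _ (chart_inv c @` K)); first exact: mfd_hausdorff.
  apply: continuous_compact cK; apply: continuous_in_subspaceT => y yK.
  by apply: chart_inv_cont; apply: eC; rewrite inE in yK.
have xK : nbhs (chart_map c x) K by apply/nbhs_closedballP; exists e.
apply: filterS (chart_near cx xK) => z [cz Kz].
by exists (chart_map c z) => //; rewrite chart_mapK.
Qed.

Lemma countable_basis (T : topologicalType) : @second_countable T ->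
  exists b : nat -> set T, (forall n, open (b n)) /\
    forall x U, nbhs x U -> exists n, b n x /\ b n `<=` U.
Proof.
move=> [B /countable_injP[f injf] [oB Bx]].
(* The union has at most one member, since [f] is injective on [B]; it makes
   [b n] open also when no basic set has number [n]. *)
pose b n := \bigcup_(A in [set A | B A /\ f A = n]) A.
exists b; split=> [n|x U /Bx[A [BA Ax] AU]].
  by apply: bigcup_open => A [/oB].
have bA : b (f A) = A.
  apply/seteqP; split=> [y [A' [BA' fA]]|y Ay]; last by exists A.
  by rewrite (injf A' A) ?inE.
by exists (f A); rewrite bA.
Qed.

End ManifoldLemmas.

(** * Universal measurability *)

Section Measurability.
Context {R : realType}.

Lemma universally_measurable_sigma_algebra :
  sigma_algebra setT (@universally_measurable R).
Proof.
split=> [P|A mA P|A mA P].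
- by exists set0, set0; split=> //; rewrite setD0 measure0.
- have [B [C [mB mC BA AC PBC]]] := mA P.
  exists (~` C), (~` B); split; [exact: measurableC|exact: measurableC| | |].
  + by rewrite setTD; exact: subsetC.
  + by rewrite setTD; exact: subsetC.
  + by rewrite setDE setCK setIC -setDE.
- have /choice[B /choice[C BC]] := fun k => mA k P.
  exists (\bigcup_k B k), (\bigcup_k C k); split.
  + by apply: bigcup_measurable => k _; case: (BC k).
  + by apply: bigcup_measurable => k _; case: (BC k).
  + by apply: subset_bigcup => k _; case: (BC k).
  + by apply: subset_bigcup => k _; case: (BC k).
  + have mD k : measurable (C k `\` B k).
      by apply: measurableD; case: (BC k).
    have nD : P.-negligible (\bigcup_k (C k `\` B k)).
      apply: negligible_bigcup => k; apply/negligibleP; first exact: mD.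
      by case: (BC k).
    apply: measure_negligible.
      by apply: measurableD; apply: bigcup_measurable => k _; case: (BC k).
    apply: negligibleS nD => w [[k _ Ckw] nB]; exists k => //; split=> // Bkw.
    by apply: nB; exists k.
Qed.

(** The sample space as a measurable type whose measurable sets are the
    universally measurable ones, to reuse the closure lemmas of sigma-algebras. *)
Definition um_type : Type := g_sigma_algebraType (@universally_measurable R).

HB.instance Definition _ := Measurable.on um_type.

Lemma um_measurableE (A : set (Omega R)) :
  universally_measurable A <-> measurable (A : set um_type).
Proof.
suff -> : @measurable _ um_type = @universally_measurable R by [].
exact: measurable_g_measurableTypeE universally_measurable_sigma_algebra.
Qed.

Lemma measurable_wrt_borel (T : topologicalType) (f : Omega R -> T) :
  (forall U, open U -> universally_measurable (f @^-1` U)) ->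
  measurable_wrt (@universally_measurable R) (@borel T) f.
Proof.
move=> mf; apply: smallest_sub => //; split=> [|A|A].
- by rewrite preimage_set0; apply/um_measurableE.
- rewrite setTD preimage_setC => /um_measurableE mA.
  exact/um_measurableE/measurableC.
- move=> mA; rewrite preimage_bigcup; apply/um_measurableE.
  by apply: bigcupT_measurable => k; exact/um_measurableE.
Qed.

Lemma open_borel (T : topologicalType) (U : set T) : open U -> borel U.
Proof. exact: sub_sigma_algebra. Qed.

Lemma rV_rat_dense n (x : 'rV[R]_n) (A : set 'rV[R]_n) : nbhs x A ->
  exists q : 'rV[rat]_n, A (map_mx ratr q).
Proof.
move=> /nbhs_ballP[e /= e0 eA].
have /choice[q Hq] : forall j, exists r : rat, `|x ord0 j - ratr r| < e.
  move=> j; have /rat_in_itvoo[r] : x ord0 j - e < x ord0 j + e.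
    by rewrite ltrBlDr -addrA ltrDl addr_gt0.
  rewrite in_itv/= => /andP[r1 r2]; exists r.
  by rewrite distrC ltr_norml ltrBrDl r1/= ltrBlDl.
by exists (\row_j q j); apply: eA; apply/rV_ballP => // j; rewrite !mxE.
Qed.

(** A function that is continuous in one variable and measurable in the other may
    be composed with measurable maps in both. By regularity, an open set [U] is the
    union of the closures of the basic sets [b j] with closure inside [U]. Then
    [p (g w, Phi w)] lies in [U] if and only if, for some such [j] and some radius,
    [p (q, Phi w)] lies in the closure of [b j] for every rational [q] within that
    radius of [g w]; this condition is built from countably many measurable ones. *)
Lemma caratheodory_comp n (T : topologicalType) (p : 'rV[R]_n * Omega R -> T)
    (g : Omega R -> 'rV[R]_n) (Phi : Omega R -> Omega R) :
  @regular_space T -> @second_countable T ->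
  (forall w, continuous (fun x => p (x, w))) ->
  (forall x, measurable_wrt (@universally_measurable R) (@borel T)
     (fun w => p (x, w))) ->
  measurable_wrt (@universally_measurable R) (@borel 'rV[R]_n) g ->
  sample_endo Phi ->
  measurable_wrt (@universally_measurable R) (@borel T)
    (fun w => p (g w, Phi w)).
Proof.
move=> regT scT cp mp mg mPhi; apply: measurable_wrt_borel => U oU.
have [b [ob bx]] := countable_basis scT.
pose G N (q : 'rV[rat]_n) := ball (map_mx ratr q : 'rV[R]_n) (N.+1%:R^-1).
pose F j (q : 'rV[rat]_n) := (fun w => p (map_mx ratr q, w)) @^-1` closure (b j).
have -> : (fun w => p (g w, Phi w)) @^-1` U =
    \bigcup_(j in [set j | closure (b j) `<=` U]) \bigcup_N
      ~` \bigcup_q ((g @^-1` G N q) `&` ~` (Phi @^-1` F j q)).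
  apply/seteqP; split=> [w /= Uw|w [j bU [N _ HN]] /=].
    have [V xV VU] := regT _ _ (open_nbhs_nbhs (conj oU Uw)).
    have [j [bjx bjV]] := bx _ _ xV.
    exists j; first exact: subset_trans (closureS bjV) VU.
    have : nbhs (g w) ((fun x => p (x, Phi w)) @^-1` b j).
      by apply: (cp (Phi w) (g w)); exact: open_nbhs_nbhs.
    move=> /nbhs_ballP[e /= e0 He].
    have [N _ /(_ N (leqnn N)) /= Ne] := near_infty_natSinv_lt (PosNum e0).
    exists N => // -[q _ [Gq]]; apply; apply: subset_closure; apply: He.
    by apply: le_ball (ltW Ne) _ _; exact: ball_sym.
  apply: bU; apply: contrapT => nb; apply: HN.
  have : nbhs (g w) ((fun x => p (x, Phi w)) @^-1` (~` closure (b j))).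
    apply: (cp (Phi w) (g w)); apply: open_nbhs_nbhs; split=> //.
    by apply: closed_openC; exact: closed_closure.
  move=> nb'; have [|q [/= Gq qj]] := @rV_rat_dense _ (g w)
    (ball (g w) N.+1%:R^-1 `&` (fun x => p (x, Phi w)) @^-1` (~` closure (b j))).
    by apply: filterI => //; apply: nbhsx_ballx.
  by exists q => //; split => //; exact: ball_sym.
apply/um_measurableE; apply: bigcup_measurable => j _.
apply: bigcup_measurable => N _; apply: measurableC.
apply: countable_bigcupT_measurable => [|q]; first exact: countableP.
apply: measurableI.
  by apply/um_measurableE; apply: mg; apply: open_borel; exact: ball_open.
apply: measurableC; apply/um_measurableE; apply: mPhi; apply: mp.
rewrite -[closure _]setCK -setTD; apply: sigma_algebraCD; apply: open_borel.
by apply: closed_openC; exact: closed_closure.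
Qed.

Lemma measurable_wrt_cst (T : topologicalType) (a : T) :
  measurable_wrt (@universally_measurable R) (@borel T) (fun=> a).
Proof.
move=> B _; apply/um_measurableE; rewrite preimage_cst.
by case: ifP => _; [exact: measurableT|exact: measurable0].
Qed.

Lemma measurable_wrt_continuous (T S : topologicalType) (f : T -> S)
    (g : Omega R -> T) : continuous f ->
  measurable_wrt (@universally_measurable R) (@borel T) g ->
  measurable_wrt (@universally_measurable R) (@borel S) (f \o g).
Proof.
move=> cf mg; apply: measurable_wrt_borel => U oU; rewrite comp_preimage.
by apply: mg; apply: open_borel; move/continuousP: cf; exact.
Qed.

(** A site morphism [(g, Phi)] moves the parameter and the sample simultaneously, so
    that measurability of the pullback needs [caratheodory_comp]. *)
Lemma manifold_plots_sample_smooth (M : @manifold R) :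
  is_sample_smooth (@manifold_plots R M).
Proof.
split=> [n x|m n p _ [sp mp] [g [Phi [[sg mg] mPhi ->]]]].
  by split=> [w|t]; [exact: smooth_map_cst|exact: measurable_wrt_cst].
split=> [w|t].
  exact: smooth_map_comp (smooth_map_euclidean (sg w)) (sp (Phi w)).
apply: (@caratheodory_comp n M p (fun w => g (t, w)) Phi) => // [||w].
- exact: manifold_regular.
- exact: mfd_second_countable.
- by case: (sp w).
Qed.

Lemma manifold_plots_smooth_map (M N : @manifold R) (f : M -> N) :
  smooth_map f ->
  sample_smooth_map (@manifold_plots R M) (@manifold_plots R N) f.
Proof.
move=> sf n p [sp mp]; split=> [w|t].
  exact: smooth_map_comp (sp w) sf.
by apply: (@measurable_wrt_continuous _ _ f (fun w => p (t, w))) => //; case: sf.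
Qed.

End Measurability.

(** * Products of manifolds through their universal property *)

Section Products.
Context {R : realType}.

(** The triple [q] consists of a parametrization, a section of it and a
    neighbourhood on which this section is a right inverse; packing them in one
    witness allows a simultaneous choice over all factors of a product. *)
Lemma local_section (M : @manifold R) (x : M) :
  exists q : ('rV[R]_(mfd_dim M) -> M) * (M -> 'rV[R]_(mfd_dim M)) * set M,
  [/\ @smooth_map R (euclidean (mfd_dim M)) M q.1.1, nbhs x q.2,
      {for x, continuous q.1.2} & forall z, q.2 z -> q.1.1 (q.1.2 z) = z].
Proof.
have [c [phi [psi [B [[_ cx] [oB Bx _] sphi spsi phiK]]]]] :=
  local_parametrization x.
exists (phi, psi \o chart_map c, [set z | chart_dom c z /\ B (chart_map c z)]).
split=> //=.
- exact: chart_near cx (open_nbhs_nbhs (conj oB Bx)).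
- by apply: continuous_comp; [exact: chart_map_cont|exact: (spsi 0%N)].
- by move=> z [cz Bz]; rewrite phiK// chart_mapK.
Qed.

Variables (I : finType) (X : I -> @manifold R) (P : @manifold R).
Variable (pi : forall i, @Defs.hom (Man R) P (X i)).
Hypothesis prodP : @is_product (Man R) I X P pi.

Let pr i : P -> X i := sval (pi i).

Lemma manifold_product_lift (Q : @manifold R) (f : forall i, Q -> X i) :
  (forall i, smooth_map (f i)) ->
  exists2 h : Q -> P, smooth_map h & forall i q, pr i (h q) = f i q.
Proof.
move=> sf; have [h [hf _]] := prodP (fun i => exist _ (f i) (sf i)).
exists (sval h) => [|i q]; first exact: svalP.
exact: (congr1 (fun g => sval g q) (hf i)).
Qed.

(** Points are constant maps from a one-point manifold, and these are determined
    by their projections. *)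
Lemma manifold_product_ext (x y : P) : (forall i, pr i x = pr i y) -> x = y.
Proof.
move=> xy; pose cst z : @Defs.hom (Man R) (euclidean 0) P :=
  exist _ (fun=> z) (smooth_map_cst (euclidean 0) z).
have [h [_ uh]] := prodP (fun i => Defs.comp (pi i) (cst x)).
have hx : h = cst x by exact: uh.
have hy : h = cst y.
  by apply: uh => i; apply: sval_inj; apply/funext => t /=; exact/esym/xy.
by have /(congr1 (fun g => sval g 0)) : cst x = cst y by rewrite -hx.
Qed.

(** The space R^N is the product of the model spaces of the factors: its coordinates
   are indexed by pairs of a factor and a coordinate of it. *)
Let N := #|{: {i : I & 'I_(mfd_dim (X i))}}|.

Let block i (v : 'rV[R]_N) : 'rV[R]_(mfd_dim (X i)) :=
  \row_j v ord0 (enum_rank (existT (fun i => 'I_(mfd_dim (X i))) i j)).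

Let glue (t : forall i, 'rV[R]_(mfd_dim (X i))) : 'rV[R]_N :=
  \row_k t (tag (enum_val k)) ord0 (tagged (enum_val k)).

Let blockK t i : block i (glue t) = t i.
Proof. by apply/rowP => j; rewrite !mxE enum_rankK. Qed.

Let smooth_block i : smooth_on setT (block i).
Proof.
apply: smooth_on_rowP => [|j]; first exact: openT.
by under eq_fun do rewrite mxE; apply: smooth_on_coord; exact: openT.
Qed.

(** The product carries the initial topology of its projections. Local
    parametrizations [phi i] of the factors induce, by the universal property, a
    continuous map [k : R^N -> P] whose i-th component is [phi i] applied to the
    i-th block of coordinates. A small cube
    around the parameter of [x] is mapped by [k] into [U], and a point whose
    projections have parameters in this cube is the [k]-image of these parameters,
    since points of [P] are determined by their projections. *)
Lemma manifold_product_nbhs (x : P) (U : set P) : nbhs x U ->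
  exists2 V : forall i, set (X i), (forall i, nbhs (pr i x) (V i)) &
    forall y, (forall i, V i (pr i y)) -> U y.
Proof.
move=> xU; pose S i := cid (local_section (pr i x)).
pose phi i := (sval (S i)).1.1; pose sec i := (sval (S i)).1.2.
pose W i := (sval (S i)).2.
have sphi i : @smooth_map R (euclidean (mfd_dim (X i))) (X i) (phi i).
  by have [] := svalP (S i).
have xW i : nbhs (pr i x) (W i) by have [] := svalP (S i).
have csec i : {for pr i x, continuous (sec i)} by have [] := svalP (S i).
have phiK i z : W i z -> phi i (sec i z) = z.
  by have [_ _ _] := svalP (S i); apply.
have [k [ck _] pk] := @manifold_product_lift (euclidean N)
  (fun i => phi i \o block i)
  (fun i => smooth_map_comp (smooth_map_euclidean (smooth_block i)) (sphi i)).
have kglue y : (forall i, W i (pr i y)) -> k (glue (fun i => sec i (pr i y))) = y.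
  move=> Wy; apply: manifold_product_ext => i.
  by rewrite pk /= blockK phiK.
pose t0 := glue (fun i => sec i (pr i x)).
have kt0 : k t0 = x by apply: kglue => i; exact: nbhs_singleton.
have /nbhs_ballP[e /= e0 eU] : nbhs t0 (k @^-1` U).
  by apply: (ck t0); rewrite kt0.
exists (fun i => W i `&` sec i @^-1` ball (sec i (pr i x)) e) => [i|y Vy].
  by apply: filterI => //; apply: csec; exact: nbhsx_ballx.
rewrite -(kglue y) => [|i]; last by case: (Vy i).
apply: eU; apply/rV_ballP => // j; rewrite !mxE.
have [_ By] := Vy (tag (enum_val j)).
exact: ((rV_ballP _ _ e0).1 By).
Qed.

(** An open set of [P] is a union of finite intersections of preimages of basic open
    sets of the factors, and there are only countably many such intersections. *)
Lemma manifold_product_measurable (q : Omega R -> P) :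
  (forall i, measurable_wrt (@universally_measurable R) (@borel (X i))
     (fun w => pr i (q w))) ->
  measurable_wrt (@universally_measurable R) (@borel P) q.
Proof.
move=> mq; apply: measurable_wrt_borel => U oU.
pose S i := cid (countable_basis (@mfd_second_countable R (X i))).
pose b i := sval (S i).
have ob i n : open (b i n) by have [+ _] := svalP (S i); apply.
have bx i (x : X i) V : nbhs x V -> exists n, b i n x /\ b i n `<=` V.
  by have [_] := svalP (S i); apply.
pose F (s : {ffun I -> nat}) := [set y | forall i, b i (s i) (pr i y)].
have -> : q @^-1` U =
    \bigcup_s [set w | F s `<=` U /\ F s (q w)].
  apply/seteqP; split=> [w /= Uw|w [s _ [FU Fw]]]; last exact: FU.
  have [V xV VU] := manifold_product_nbhs (open_nbhs_nbhs (conj oU Uw)).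
  have /choice[s bs] := fun i => bx _ _ _ (xV i).
  exists [ffun i => s i] => //; split=> [y Fy|i]; last first.
    by rewrite ffunE; case: (bs i).
  by apply: VU => i; have [_] := bs i; apply; have := Fy i; rewrite ffunE.
apply/um_measurableE; apply: countable_bigcupT_measurable => [|s].
  exact: countableP.
have [FU|nFU] := pselect (F s `<=` U); last first.
  by rewrite (_ : [set _ | _] = set0)// -subset0 => w [].
have -> : [set w | F s `<=` U /\ F s (q w)] =
    ~` \bigcup_i ~` ((fun w => pr i (q w)) @^-1` b i (s i)).
  apply/seteqP; split=> [w [_ Fw] [i _]|w Hw]; first by apply; exact: Fw.
  by split=> // i; apply: contrapT => nb; apply: Hw; exists i.
apply: measurableC; apply: countable_bigcupT_measurable => [|i].
  exact: countableP.
by apply: measurableC; apply/um_measurableE; apply: mq; exact: open_borel.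
Qed.

End Products.

Theorem theorem4p27 (R : realType) :
  exists (Hob : forall M : @manifold R, is_sample_smooth (@manifold_plots R M))
         (Hmor : forall (M N : @manifold R) (f : M -> N), smooth_map f ->
            sample_smooth_map (@manifold_plots R M) (@manifold_plots R N) f),
    let F := manifold_functor Hob Hmor in
    [/\ full F, faithful F & preserves_finite_products F].
Proof.
exists manifold_plots_sample_smooth, manifold_plots_smooth_map => F; split.
- move=> M N [h sh].
  have smh : smooth_map h.
    apply: smooth_map_detect => p sp.
    have [|smhp _] := sh (mfd_dim M) (fun x => p x.1); last exact: smhp point.
    by split=> // t; exact: (measurable_wrt_cst (p t)).
  by exists (exist _ h smh); exact: sval_inj.
- by move=> M N f g fg; apply: sval_inj; exact: (congr1 sval fg).
- move=> I X P pi prodP Q f.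
  (* Testing the product on a point identifies the points of [P] with the families
     of points of the factors, which determines the mediating map as a function. *)
  have /choice[h hf] : forall x : Q, exists y, forall i,
      sval (pi i) y = sval (f i) x.
    move=> x; have [k _ pk] := manifold_product_lift prodP
      (fun i => smooth_map_cst (euclidean 0) (sval (f i) x)).
    by exists (k 0) => i; rewrite pk.
  have sh : sample_smooth_map (@sss_plots R Q) (@manifold_plots R P) h.
    move=> n c Qc; have fc i := svalP (f i) n c Qc.
    split=> [w|t].
      have [k sk pk] := manifold_product_lift prodP (fun i => (fc i).1 w).
      rewrite (_ : (fun t => _) = k)//; apply/funext => t /=.
      by apply: (manifold_product_ext prodP) => i; rewrite hf pk.
    apply: (manifold_product_measurable prodP) => i /=.
    by under eq_fun do rewrite hf; exact: (fc i).2.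
  exists (exist _ h sh : @Defs.hom (SSS R) Q (F P)); split=> [i|h' hf'].
    by apply: sval_inj; apply/funext => x /=; exact: hf.
  apply: sval_inj; apply/funext => x /=.
  apply: (manifold_product_ext prodP) => i.
  by rewrite hf; exact: (congr1 (fun g => sval g x) (esym (hf' i))).
Qed.
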